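(* Let $p\in[1,\infty)$ and let $\Phi$ be an almost increasing set function defined on cubes (or balls) of $\mathbb{R}^n$. Then $$\sup_{\ell\in(0,\infty),\,\{Q_j\}_j\in\Pi_\ell}\Big\{\sum_j|Q_j|\,[\Phi(Q_j)]^p\Big\}^{1/p}\sim\sup_{\ell\in(0,\infty)}\Big\{\int_{\mathbb{R}^n}[\Phi(Q(z,\ell))]^p\,dz\Big\}^{1/p}\sim\sup_{k\in\mathbb{Z},\,\{Q_j\}_j\in\Pi_{2^k}}\Big\{\sum_j|Q_j|\,[\Phi(Q_j)]^p\Big\}^{1/p}$$ with the positive equivalence constants depending only on $n$ and $\Phi$. Moreover, these equivalences also hold true with $Q(z,\ell)$ replaced by $B(z,\ell):=\{x\in\mathbb{R}^n:\ |x-z|<\ell\}$.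
   Context: A cube has finite edge length and all its edges parallel to the coordinate axes, and is not necessarily open or closed. For any $z\in\mathbb{R}^n$ and $\ell\in(0,\infty)$, $Q(z,\ell)$ denotes the cube centered at $z$ with edge length $\ell$. For any $\ell\in(0,\infty)$, $\Pi_\ell$ denotes the class of all collections $\{Q_j\}_j$ of subcubes of $\mathbb{R}^n$ with pairwise disjoint interiors and equal edge length $\ell$. $|E|$ denotes the Lebesgue measure of $E$. A non-negative set function $\Phi$ on all cubes (or balls) is said to be almost increasing if there exists a positive constant $C$ such that, for any cubes (or balls) $Q_1$, $Q_2$ satisfying $Q_1\subset Q_2$ and $|Q_1|\le 2^{-n}|Q_2|$, it holds true that $\Phi(Q_1)\le C\,\Phi(Q_2)$. $A\sim B$ means $c^{-1}A\le B\le cA$ for some positive constant $c$ (the equivalence constant). *)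

(* Defs.v *)
From HB Require Import structures.
From mathcomp Require Import all_boot all_order all_algebra.
From mathcomp Require Import all_classical all_reals all_analysis.

Set Implicit Arguments.
Unset Strict Implicit.
Unset Printing Implicit Defensive.

Import Order.TTheory GRing.Theory Num.Theory.
Import numFieldTopology.Exports numFieldNormedType.Exports.

Local Open Scope classical_set_scope.
Local Open Scope ring_scope.

(* The Borel sigma-algebra of R^n, presented as the product sigma-algebra
   generated by the coordinate functions. *)
Section measurable_rV.
Context {R : realType} {n : nat}.

Definition rV_coord (i : 'I_n) (x : 'rV[R]_n) : R := x ord0 i.

Let rV_set0 : g_sigma_preimage rV_coord set0.
Proof. exact: sigma_algebra0. Qed.

Let rV_setC A : g_sigma_preimage rV_coord A -> g_sigma_preimage rV_coord (~` A).
Proof. exact: sigma_algebraC. Qed.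

Let rV_bigcup (F : (set 'rV[R]_n)^nat) :
  (forall i, g_sigma_preimage rV_coord (F i)) ->
  g_sigma_preimage rV_coord (\bigcup_i F i).
Proof. exact: sigma_algebra_bigcup. Qed.

HB.instance Definition _ := @isMeasurable.Build
  (measure_tuple_display default_measure_display)
  'rV[R]_n (g_sigma_preimage rV_coord) rV_set0 rV_setC rV_bigcup.

Lemma measurable_rV_coord (i : 'I_n) : measurable_fun [set: 'rV[R]_n] (rV_coord i).
Proof.
move=> _ Y mY; rewrite setTI; apply: sub_sigma_algebra => /=.
rewrite -bigcup_seq/=; exists i => /=; first by rewrite mem_index_enum.
by exists Y => //; rewrite setTI.
Qed.

Lemma measurable_fun_rVP d (T : measurableType d) (f : T -> 'rV[R]_n) :
  (forall i, measurable_fun [set: T] (rV_coord i \o f)) ->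
  measurable_fun [set: T] f.
Proof.
move=> mf _ A mA; rewrite setTI.
have : preimage_set_system setT f (g_sigma_preimage rV_coord) (f @^-1` A).
  by exists A => //; rewrite setTI.
rewrite -g_sigma_preimage_comp; apply: smallest_sub.
  exact: sigma_algebra_measurable.
rewrite -bigcup_seq/=; apply: bigcup_sub => i _ _ [B mB <-].
exact: mf.
Qed.

End measurable_rV.

Section lebesgue_rV.
Context {R : realType}.

Definition rV_cons n (vx : 'rV[R]_n * measurableTypeR R) : 'rV[R]_n.+1 :=
  row_mx (vx.2)%:M vx.1.

Lemma measurable_rV_cons n : measurable_fun setT (@rV_cons n).
Proof.
apply: measurable_fun_rVP => i.
have [j ->|j ->] := split_ordP (i : 'I_(1 + n)).
  rewrite (_ : _ \o _ = fun vx => (vx.2 : R)); first exact: measurable_snd.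
  apply/funext => vx; apply: etrans (row_mxEl _ _ _ _) _.
  by rewrite !mxE !ord1 eqxx.
rewrite (_ : _ \o _ = rV_coord j \o fst).
  by apply: measurableT_comp; [exact: measurable_rV_coord|exact: measurable_fst].
by apply/funext => vx; exact: row_mxEr.
Qed.

(* Lebesgue measure on R^n (restricted to Borel sets): the n-fold product of
   the one-dimensional Lebesgue measure. *)
Fixpoint lebesgue_rV (n : nat) : {measure set 'rV[R]_n -> \bar R} :=
  match n with
  | 0 => dirac (0 : 'rV[R]_0)
  | n'.+1 =>
    measure_function_pushforward__canonical__measure_function_Measure
      (lebesgue_rV n' \x lebesgue_measure)%E (@measurable_rV_cons n')
  end.

End lebesgue_rV.

Lemma measurable_box (R : realType) n (A : 'I_n -> set R) :
  (forall i, measurable (A i)) ->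
  measurable [set x : 'rV[R]_n | forall i, A i (x ord0 i)].
Proof.
move=> mA; rewrite (_ : [set _ | _] = \bigcap_(i in [set: 'I_n]) (@rV_coord R n i @^-1` A i)); last first.
  by apply/seteqP; split => x /= h i; [move=> _; exact: h|exact: (h i I)].
apply: fin_bigcap_measurable => // i _.
by rewrite -[X in measurable X]setTI; exact: measurable_rV_coord.
Qed.

Lemma lebesgue_rV_box (R : realType) n (A : 'I_n -> set R) :
  (forall i, measurable (A i)) ->
  lebesgue_rV n [set x : 'rV[R]_n | forall i, A i (x ord0 i)] =
  (\prod_(i < n) lebesgue_measure (A i))%E.
Proof.
elim: n A => [|n IH] A mA.
  rewrite big_ord0 /= /dirac indicE mem_set//= => -[].
  done.
rewrite big_ord_recl /= /pushforward.
rewrite (_ : _ @^-1` _ = [set x : 'rV[R]_n | forall i, A (lift ord0 i) (x ord0 i)] `*` A ord0).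
  rewrite product_measure1E.
  - by rewrite (IH (fun i => A (lift ord0 i)) (fun i => mA _)) muleC.
  - exact: (@measurable_box R n (fun i => A (lift ord0 i)) (fun i => mA _)).
  - exact: (mA ord0).
have E0 (x : 'rV[R]_n * measurableTypeR R) : rV_cons x ord0 ord0 = x.2.
  have h := row_mxEl (x.2%:M : 'M[R]_1) x.1 ord0 ord0; rewrite [RHS]mxE in h.
  apply: etrans h; rewrite /rV_cons; f_equal; exact: val_inj.
have E1 (x : 'rV[R]_n * measurableTypeR R) i : rV_cons x ord0 (lift ord0 i) = x.1 ord0 i.
  have h := row_mxEr (x.2%:M : 'M[R]_1) x.1 ord0 i.
  apply: etrans h; rewrite /rV_cons; f_equal; exact: val_inj.
apply/seteqP; split => x /= h.
  by split => [i|]; [rewrite -E1; exact: h|rewrite -E0; exact: h].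
case: h => h1 h0 i; case: (unliftP ord0 i) => [j ->|->]; first by rewrite E1.
by rewrite E0.
Qed.

Section cubes.
Context {R : realType} {n : nat}.
Implicit Types (z : 'rV[R]_n) (l : R) (Q : set 'rV[R]_n).

(* Q is a cube centered at z with edge length l: a product of n intervals of
   length l, each of which may be open, closed or half-open. *)
Definition is_cube_at z l Q := exists bl br : 'I_n -> bool,
  Q = [set x | forall i, x ord0 i \in
    Interval (BSide (bl i) (z ord0 i - l / 2)) (BSide (br i) (z ord0 i + l / 2))].

Definition cubes_of_edge l : set (set 'rV[R]_n) :=
  [set Q | exists z, is_cube_at z l Q].

Definition cubes : set (set 'rV[R]_n) :=
  [set Q | exists2 l, 0 < l & cubes_of_edge l Q].

(* The norm that MathComp-Analysis puts on 'rV[R]_n is the sup norm, hence the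
   explicit Euclidean norm. *)
Definition eball z l : set 'rV[R]_n :=
  [set x | Num.sqrt (\sum_i (x ord0 i - z ord0 i) ^+ 2) < l].

Definition balls : set (set 'rV[R]_n) :=
  [set B | exists z, exists2 l, 0 < l & B = eball z l].

(* As the interior of a cube is not empty when 0 < n, the members of a family
   with pairwise disjoint interiors are pairwise distinct, so that such a family
   is the same thing as a set of cubes. *)
Definition congruent_families l : set (set (set 'rV[R]_n)) :=
  [set F | F `<=` cubes_of_edge l /\ trivIset F (@interior 'rV[R]_n)].

End cubes.

Arguments cubes : clear implicits.
Arguments balls : clear implicits.

Section set_functions.
Context {R : realType} {n : nat}.
Local Open Scope ereal_scope.
Local Notation mu := (@lebesgue_rV R n).
Implicit Types (D : set (set 'rV[R]_n)) (Phi : set 'rV[R]_n -> \bar R) (p : R).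

(* Phi is a non-negative almost increasing set function on the class D; its
   values outside D are irrelevant. *)
Definition almost_increasing D Phi :=
  (forall Q, D Q -> 0 <= Phi Q) /\
  exists2 C : R, (0 < C)%R & forall Q1 Q2, D Q1 -> D Q2 ->
    Q1 `<=` Q2 -> mu Q1 <= (2 ^- n)%:E * mu Q2 -> Phi Q1 <= C%:E * Phi Q2.

Definition cube_sum Phi p (F : set (set 'rV[R]_n)) : \bar R :=
  (\esum_(Q in F) (mu Q * Phi Q `^ p)) `^ p^-1.

Definition sup_cubes Phi p : \bar R :=
  ereal_sup [set s | exists2 l : R, (0 < l)%R &
    exists2 F, congruent_families l F & s = cube_sum Phi p F].

Definition sup_dyadic_cubes Phi p : \bar R :=
  ereal_sup [set s | exists k : int,
    exists2 F, congruent_families (2 ^ k)%R F & s = cube_sum Phi p F].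

(* For a function that is not measurable, the integral of the library is the
   lower integral. *)
Definition sup_integral Phi p (S : 'rV[R]_n -> R -> set 'rV[R]_n) : \bar R :=
  ereal_sup [set s | exists2 l : R, (0 < l)%R &
    s = (\int[mu]_z (Phi (S z l) `^ p)) `^ p^-1].

End set_functions.

Definition ereal_sim {R : realType} (c : R) (A B : \bar R) :=
  ((c^-1)%:E * A <= B /\ B <= c%:E * A)%E.

(* Main.v *)
Require Import Defs.
From mathcomp Require Import all_boot all_order all_algebra.
From mathcomp Require Import all_classical all_reals all_analysis.
From mathcomp Require Import measurable_realfun ring lra.
Set Implicit Arguments.
Unset Strict Implicit.
Unset Printing Implicit Defensive.

Import Order.TTheory GRing.Theory Num.Theory.
Import numFieldNormedType.Exports.
Local Open Scope classical_set_scope.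
Local Open Scope ring_scope.

(** Write A, B and A' for the three quantities, in the order of the statement.
    Three inequalities give everything, with the constant C of almost
    monotonicity itself as equivalence constant: A' <= A, A <= C B, B <= C A'.

    - A' <= A holds because dyadic edge lengths are edge lengths.

    - A <= C B (sup_cubes_le_integral). Let Q_j be cubes of edge length l with
      disjoint interiors. For every z in Q_j the cube Q_j lies in Q(z, 4l), or in
      B(z, (n+1)l), so that Phi(Q_j) <= C Phi(Q(z, 4l)). Integrating the p-th
      powers of these inequalities over the disjoint interiors of the Q_j yields
      sum_j |Q_j| Phi(Q_j)^p <= C^p int Phi(Q(z, 4l))^p dz.

    - B <= C A' (sup_integral_le_dyadic). Choose a power L of 2 with L >= 2l and
      cut R^n into grid cells of edge length L. If z lies in a cell E, then
      Q(z, l), or B(z, l), lies in the concentric double 2E of that cell, so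
      int Phi(Q(z, l))^p dz <= C^p sum_E |E| Phi(2E)^p. The doubles overlap, but
      the cells fall into 2^n parity classes, and within one class the doubles
      tile R^n. Hence each class contributes at most 2^-n A'^p, because
      |E| = 2^-n |2E|, and the 2^n classes together contribute at most A'^p.

    Cubes and balls are handled at once: all that matters about the sets S(z, l)
    over which Phi is evaluated is that they are trapped between sup-norm balls
    centered at z, of radius l from the outside and, after dilation by a fixed
    factor, of radius l from the inside.

    The function z |-> Phi(S(z, l))^p may fail to be measurable, and its integral
    is then a lower integral, which is not additive. It is still monotone, and
    that suffices: it dominates the sums attached to packings
    (packing_le_integral) and is dominated by the sums attached to coverings
    (integral_le_covering). *)

(** * Lower integrals against packings and coverings *)

Section lower_integral.
Local Open Scope ereal_scope.
Context d (T : measurableType d) (R : realType) (mu : {measure set T -> \bar R}).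
Implicit Types (f g : T -> \bar R).

(** By definition the integral of f is the supremum of the integrals of the simple
    functions below f, and these are among the simple functions below g. *)
Lemma ge0_le_lower_integral f g :
  (forall x, 0 <= f x) -> (forall x, f x <= g x) ->
  \int[mu]_x f x <= \int[mu]_x g x.
Proof.
move=> f0 fg; have g0 x : 0 <= g x by exact: le_trans (fg x).
rewrite !ge0_integralTE//; apply: ereal_sup_le => _ [h hf <-].
by exists h => // x; exact: le_trans (fg x).
Qed.

(** A finite part of the sum on the left is the integral of a measurable step
    function, which lies below f because the sets O i are disjoint. *)
Lemma packing_le_integral (I : choiceType) (J : set I) (O : I -> set T)
    (a : I -> \bar R) f :
  (forall i, measurable (O i)) -> trivIset J O -> (forall i, 0 <= a i) ->
  (forall x, 0 <= f x) -> (forall i x, J i -> O i x -> a i <= f x) ->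
  \esum_(i in J) (a i * mu (O i)) <= \int[mu]_x f x.
Proof.
move=> mO tO a0 f0 af; apply: ge_ereal_sup => _ [X [finX XJ] <-].
have h0 i x : 0 <= (cst (a i) \_ (O i)) x.
  by rewrite patchE; case: ifP => // _; exact: a0.
have -> : \sum_(i \in X) (a i * mu (O i)) =
    \sum_(i \in X) \int[mu]_x (cst (a i) \_ (O i)) x.
  by apply: eq_fsbigr => i _; rewrite -integral_mkcond integral_cst.
rewrite -ge0_integral_fsum//; last first.
  by move=> i; apply: (measurable_restrictT _ (mO i)).1; exact: measurable_cst.
apply: ge0_le_lower_integral => x; first exact: fsume_ge0.
have [[i Xi Oix]|nO] := pselect (exists2 i, X i & O i x).
  rewrite (fsbigD1 i)//= fsbig1 ?adde0.
    by rewrite patchE mem_set//; apply: af => //; exact: XJ.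
  move=> k [Xk /= ki]; rewrite patchE memNset// => Okx; apply: ki.
  by apply: tO; [exact: XJ|exact: XJ|exists x].
rewrite fsbig1// => i Xi; rewrite patchE memNset// => Oix.
by apply: nO; exists i.
Qed.

(** The sum of the functions equal to a j on E j and to 0 elsewhere is measurable
    and lies above f, because the sets E j cover the space. *)
Lemma integral_le_covering (J : countType) (E : J -> set T) (a : J -> \bar R) f :
  (forall j, measurable (E j)) -> (forall j, 0 <= a j) ->
  (forall x, 0 <= f x) -> (forall x, exists2 j, E j x & f x <= a j) ->
  \int[mu]_x f x <= \esum_(j in [set: J]) (a j * mu (E j)).
Proof.
move=> mE a0 f0 fa.
(* The series theorem for integrals is about sequences, so J is enumerated by
   its coding into nat; the numbers that code nothing contribute 0. *)
pose h k : T -> \bar R := oapp (fun j : J => cst (a j) \_ (E j)) (cst 0) (pickle_inv k).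
have h0 k x : 0 <= h k x.
  rewrite /h; case: pickle_inv => [j|]//=.
  by rewrite patchE; case: ifP => // _; exact: a0.
apply: (@le_trans _ _ (\int[mu]_x \sum_(k <oo) h k x)).
  apply: ge0_le_lower_integral => // x.
  have [j Ejx /le_trans] := fa x; apply.
  rewrite nneseries_esumT//; apply: esum_ge; exists [set pickle j].
    by split => //; exact: finite_set1.
  by rewrite fsbig_set1 /h pickleK_inv/= patchE mem_set.
rewrite integral_nneseries//; last first.
  move=> k; rewrite /h; case: pickle_inv => [j|]/=; last exact: measurable_cst.
  by apply: (measurable_restrictT _ (mE j)).1; exact: measurable_cst.
rewrite nneseries_esumT; last by move=> k; exact: integral_ge0.
have inj : set_inj [set: J] pickle by move=> i j _ _; exact: (pcan_inj pickleK_inv).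
rewrite (eq_esum (b := fun k => if k \in range (@pickle J) then
   oapp (fun j => a j * mu (E j)) 0 (pickle_inv k) else 0)); last first.
  move=> k _; rewrite /h; case E1 : (pickle_inv k) => [j|] /=.
    by rewrite -integral_mkcond integral_cst// mem_set//; exists j => //; move: (@pickle_invK J k); rewrite E1.
  by rewrite integral0; case: ifP.
rewrite -esum_mkcond esum_image//; apply: le_esum => j _.
by rewrite pickleK_inv.
Qed.

End lower_integral.

(** * Sums and powers of extended reals *)

Section ereal_sums.
Local Open Scope ereal_scope.
Context (R : realType).

Lemma esumZ_le (I : choiceType) (J : set I) (k : \bar R) (a : I -> \bar R) :
  0 <= k -> (forall i, 0 <= a i) ->
  \esum_(i in J) (k * a i) <= k * \esum_(i in J) a i.
Proof.
move=> k0 a0; apply: ge_ereal_sup => _ [X XJ <-].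
rewrite -ge0_mule_fsumr//; apply: lee_wpmul2l => //.
by apply: esum_ge; exists X.
Qed.

Lemma esum_finType (I : finType) (b : I -> \bar R) :
  (forall i, 0 <= b i) -> \esum_(i in [set: I]) b i = \sum_i b i.
Proof.
move=> b0; rewrite esum_fset//; last exact: finite_finset.
rewrite [RHS]fsbig_seq ?index_enum_uniq//.
by apply: eq_fsbigl; apply/seteqP; split => i //= _; rewrite mem_index_enum.
Qed.

(** This passes from an inequality between p-th powers, with constant C ^ p, to
    the norms themselves, with a constant C that is the same for all p. *)
Lemma poweR_le_root (p : R) (C s t : \bar R) : (0 < p)%R ->
  0 <= C -> 0 <= s -> 0 <= t -> s <= C `^ p * t ->
  s `^ p^-1 <= C * t `^ p^-1.
Proof.
move=> p0 C0 s0 t0 st.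
have -> : C * t `^ p^-1 = (C `^ p * t) `^ p^-1.
  by rewrite poweRM ?poweR_ge0// -poweRrM mulfV ?gt_eqF// poweRe1.
by apply: gt0_ler_poweR => //; rewrite ?invr_ge0 ?ltW// in_itv/= leey andbT// mule_ge0// poweR_ge0.
Qed.

End ereal_sums.

(** * Cubes, sup-norm balls and Euclidean balls *)

Section geometry.
Context {R : realType} {n : nat}.
Local Notation mu := (@lebesgue_rV R n).
Implicit Types (z : 'rV[R]_n) (l : R) (Q : set 'rV[R]_n).

Definition sup_ball z l : set 'rV[R]_n :=
  [set x | forall i, `|x ord0 i - z ord0 i| <= l].

Definition half_open_cube z l : set 'rV[R]_n :=
  [set x | forall i, z ord0 i - l / 2 <= x ord0 i < z ord0 i + l / 2].

Definition open_cube z l : set 'rV[R]_n :=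
  [set x | forall i, z ord0 i - l / 2 < x ord0 i < z ord0 i + l / 2].

Lemma is_cube_at_sup_ball z l : is_cube_at z (2 * l) (sup_ball z l).
Proof.
exists (fun=> true), (fun=> false); apply/seteqP; split => x /= h i;
  move: (h i); rewrite in_itv/= ler_distl => /andP[? ?]; apply/andP; split; lra.
Qed.

Lemma is_cube_at_half_open z l : is_cube_at z l (half_open_cube z l).
Proof.
exists (fun=> true), (fun=> true); apply/seteqP; split => x /= h i;
  by move: (h i); rewrite in_itv.
Qed.

Lemma is_cube_at_open z l : is_cube_at z l (open_cube z l).
Proof.
exists (fun=> false), (fun=> true); apply/seteqP; split => x /= h i;
  by move: (h i); rewrite in_itv.
Qed.

Lemma measurable_cube z l Q : is_cube_at z l Q -> measurable Q.
Proof.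
move=> [bl [br ->]].
exact: (@measurable_box R n (fun i => [set` Interval (BSide (bl i) _) (BSide (br i) _)])).
Qed.

Lemma lebesgue_cube z l Q : 0 < l -> is_cube_at z l Q -> mu Q = (l ^+ n)%:E.
Proof.
move=> l0 [bl [br ->]].
rewrite (@lebesgue_rV_box R n (fun i => [set` Interval (BSide (bl i) _) (BSide (br i) _)]))//.
rewrite (eq_bigr (fun=> l%:E)); last first.
  move=> i _; rewrite lebesgue_measure_itv/= lte_fin ifT; last by lra.
  by rewrite -EFinB; congr EFin; lra.
by rewrite prodEFin prodr_const card_ord.
Qed.

Lemma cube_sub_sup_ball z l Q : is_cube_at z l Q -> Q `<=` sup_ball z (l / 2).
Proof.
move=> [bl [br ->]] x /= h i; move: (h i).
by rewrite in_itv/= ler_distl => /andP[/lteifW -> /lteifW ->].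
Qed.

Lemma open_cube_sub z l Q : is_cube_at z l Q -> open_cube z l `<=` Q.
Proof.
move=> [bl [br ->]] x /= h i; move: (h i) => /andP[h1 h2].
by rewrite in_itv/= !lteifS.
Qed.

Lemma open_open_cube z l : open (open_cube z l).
Proof.
rewrite openE => x /= h.
have : \forall y \near x, forall i, z ord0 i - l / 2 < (y : 'rV[R]_n) ord0 i < z ord0 i + l / 2.
  apply: (@filter_forall _ _ (fun i (y : 'rV[R]_n) => is_true (z ord0 i - l / 2 < y ord0 i < z ord0 i + l / 2)) (nbhs x)) => i.
  have := @interval_open R (BRight (z ord0 i - l / 2)) (BLeft (z ord0 i + l / 2)) isT isT.
  move=> /(open_comp (f := fun y : 'rV[R]_n => y ord0 i)).
  rewrite openE => /(_ (fun y _ => @coord_continuous R _ _ ord0 i y)) /(_ x).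
  rewrite /interior/= in_itv/= => /(_ (h i)); apply: filterS => y.
  by rewrite /= in_itv.
by apply: filterS => y.
Qed.

(** The members of a family with disjoint interiors may overlap on their faces;
    this lemma provides disjoint sets inside them, of the same measure. *)
Lemma open_cube_sub_interior z l Q : is_cube_at z l Q ->
  open_cube z l `<=` interior Q.
Proof. by move=> /open_cube_sub; rewrite -open_subsetE//; exact: open_open_cube. Qed.

Lemma eball_sub_sup_ball z l : eball z l `<=` sup_ball z l.
Proof.
move=> x /= h i; apply: le_trans (ltW h).
rewrite -sqrtr_sqr ler_sqrt//; last by rewrite sumr_ge0// => j _; exact: sqr_ge0.
by rewrite (bigD1 i)//= lerDl sumr_ge0// => j _; exact: sqr_ge0.
Qed.

(** The sharp dilation factor is the square root of n; as the Euclidean ball is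
    open, a strictly larger one is needed. *)
Lemma sup_ball_sub_eball z l : 0 < l -> sup_ball z l `<=` eball z (n.+1%:R * l).
Proof.
move=> l0 x /= h; rewrite /eball/=.
rewrite -[ltRHS]ger0_norm ?mulr_ge0// ?ltW// -sqrtr_sqr ltr_sqrt; last first.
  by rewrite exprn_gt0// mulr_gt0.
apply: (@le_lt_trans _ _ (\sum_(i < n) l ^+ 2)).
  by apply: ler_sum => i _; rewrite -real_normK ?num_real// lerXn2r ?nnegrE// ltW.
rewrite sumr_const card_ord exprMn -[ltLHS]mulr_natl ltr_pM2r ?exprn_gt0//.
by rewrite -natrX ltr_nat -mulnn; apply: leq_pmulr.
Qed.

Lemma measurable_eball z l : 0 < l -> measurable (eball z l).
Proof.
move=> l0; pose g (x : 'rV[R]_n) : R := \sum_i (x ord0 i - z ord0 i) ^+ 2.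
have mg : measurable_fun setT g.
  apply: measurable_sum => i; apply: measurable_funX.
  by apply: measurable_funB => //; exact: measurable_rV_coord.
have sqrt_lt y : (Num.sqrt y < l) = (y < l ^+ 2).
  by rewrite -{1}(ger0_norm (ltW l0)) -sqrtr_sqr ltr_sqrt ?exprn_gt0.
have -> : eball z l = g @^-1` [set` `]-oo, l ^+ 2[].
  apply/seteqP; split => x /=; rewrite in_itv/= /eball/= sqrt_lt//.
by rewrite -[X in measurable X]setTI; exact: mg.
Qed.

End geometry.

(** * The shifted dyadic grids *)

Section grid.
Context {R : realType} {n : nat}.
Implicit Types (e : {ffun 'I_n -> bool}) (m : {ffun 'I_n -> int}) (L : R).

(** The points of the lattice L Z^n, written so as to display their parity class:
    e gives the parities of the integer coordinates and m their halves, rounded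
    down. *)
Definition grid_point L e m : 'rV[R]_n :=
  \row_i (L * ((e i)%:R + 2 * (m i)%:~R)).

Definition grid_cell L e m := half_open_cube (grid_point L e m) L.

(** The double of a grid cell. Being half-open, the doubles of one parity class are
    disjoint, hence so are their interiors. *)
Definition grid_cube L e m := half_open_cube (grid_point L e m) (2 * L).

(** In each coordinate, floor u is the integer nearest to z / L. Its parity and its
    half, rounded down, are read off the remainder and the quotient of u by 2, so
    that they need not be extracted from an integer. *)
Lemma grid_cell_cover L (z : 'rV[R]_n) : 0 < L ->
  exists e m, grid_cell L e m z.
Proof.
move=> L0; pose u i := z ord0 i / L + 2^-1.
pose m := [ffun i => Num.floor (u i / 2)].
exists [ffun i => 1 <= u i - 2 * (m i)%:~R], m => i; rewrite mxE ffunE.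
have zE : z ord0 i = L * (u i - 2^-1) by rewrite addrK mulrC divfK ?gt_eqF.
have : (m i)%:~R <= u i / 2 < (m i)%:~R + 1.
  by rewrite ffunE; have := floor_itv (u i / 2); rewrite intrD.
rewrite zE; set k := (m i)%:~R : R => /andP[h1 h2].
have EN b : L * b - L / 2 = L * (b - 2^-1) by ring.
have ED b : L * b + L / 2 = L * (b + 2^-1) by ring.
rewrite EN ED ler_pM2l// ltr_pM2l//.
by case: (leP 1 _) => /= h; apply/andP; split; lra.
Qed.

(** Centers of one parity class differ by multiples of 2 L, the edge length of the
    doubled cells. *)
Lemma grid_cubes_disjoint L e m m' (x : 'rV[R]_n) : 0 < L ->
  grid_cube L e m x -> grid_cube L e m' x -> m = m'.
Proof.
move=> L0 hm hm'; apply/ffunP => i.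
have lt_succ (k k' : int) : L * ((e i)%:R + 2 * k%:~R) - 2 * L / 2 <
    L * ((e i)%:R + 2 * k'%:~R) + 2 * L / 2 -> k <= k'.
  have -> : L * ((e i)%:R + 2 * k%:~R) - 2 * L / 2 = L * ((e i)%:R + 2 * k%:~R - 1) by field.
  have -> : L * ((e i)%:R + 2 * k'%:~R) + 2 * L / 2 = L * ((e i)%:R + 2 * k'%:~R + 1) by field.
  rewrite ltr_pM2l// => h; rewrite -ltzD1 -(ltr_int R) intrD; lra.
have := hm i; have := hm' i; rewrite !mxE => /andP[a1 a2] /andP[b1 b2].
apply/eqP; rewrite eq_le; apply/andP; split; apply: lt_succ.
  exact: le_lt_trans a2.
exact: le_lt_trans b2.
Qed.

Lemma sup_ball_sub_grid_cube L e m (z : 'rV[R]_n) l : 2 * l <= L ->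
  grid_cell L e m z -> sup_ball z l `<=` grid_cube L e m.
Proof.
move=> lL cz x zx i; have := cz i; have := zx i; rewrite ler_distl.
by move=> /andP[? ?] /andP[? ?]; apply/andP; split; lra.
Qed.

End grid.

(** * Comparison of the three suprema *)

Section comparison.
Context (R : realType) (n : nat).
Local Notation mu := (@lebesgue_rV R n).
Variables (D : set (set 'rV[R]_n)) (Phi : set 'rV[R]_n -> \bar R) (C : R).
Hypothesis cubesD : cubes R n `<=` D.
Hypothesis C0 : 0 < C.
Hypothesis Phi0 : forall Q, D Q -> (0 <= Phi Q)%E.
Hypothesis incr : forall Q1 Q2, D Q1 -> D Q2 -> Q1 `<=` Q2 ->
  (mu Q1 <= (2 ^- n)%:E * mu Q2)%E -> (Phi Q1 <= C%:E * Phi Q2)%E.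

(** S z l stands for Q(z, l) or B(z, l). *)
Variables (S : 'rV[R]_n -> R -> set 'rV[R]_n) (a : R).
Hypothesis a0 : 0 < a.
Hypothesis SD : forall z l, 0 < l -> D (S z l).
Hypothesis mS : forall z l, 0 < l -> measurable (S z l).
Hypothesis S_sub : forall z l, 0 < l -> S z l `<=` sup_ball z l.
Hypothesis sub_S : forall z l, 0 < l -> sup_ball z l `<=` S z (a * l).

(** The sup-norm ball of radius l at x is a cube of edge length 2 l that contains
    Q, hence a set between Q and the dilated set which is large enough for almost
    monotonicity to apply. *)
Lemma cube_le_dilation l Q x : 0 < l -> cubes_of_edge l Q -> Q x ->
  (Phi Q <= C%:E * Phi (S x (a * l)))%E.
Proof.
move=> l0 [z Qz] Qx; have Qsub := cube_sub_sup_ball Qz.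
have Qx_sub : Q `<=` sup_ball x l.
  move=> y /Qsub yz i; have := Qsub _ Qx i; have := yz i.
  rewrite !ler_distl => /andP[? ?] /andP[? ?]; apply/andP; split; lra.
have al0 : 0 < a * l by rewrite mulr_gt0.
apply: incr.
- by apply: cubesD; exists l => //; exists z.
- exact: SD.
- by apply: subset_trans (sub_S l0).
- apply: (@le_trans _ _ ((2 ^- n)%:E * mu (sup_ball x l))%E).
    rewrite (lebesgue_cube l0 Qz) (lebesgue_cube _ (is_cube_at_sup_ball x l)) ?mulr_gt0//.
    by rewrite -EFinM lee_fin exprMn mulKf// expf_neq0.
  apply: lee_wpmul2l; first by rewrite lee_fin invr_ge0 exprn_ge0.
  apply: le_measure; rewrite ?inE; [|exact: mS|exact: sub_S].
  exact: measurable_cube (is_cube_at_sup_ball x l).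
Qed.

Lemma sup_cubes_le_integral p : 1 <= p ->
  (sup_cubes Phi p <= C%:E * sup_integral Phi p S)%E.
Proof.
move=> p1; have p0 : 0 < p by exact: lt_le_trans p1.
apply: ge_ereal_sup => _ [l l0 [F [Fl tF] ->]].
have al0 : 0 < a * l by rewrite mulr_gt0.
have FD Q : F Q -> D Q by move=> /Fl lQ; apply: cubesD; exists l.
pose I := (\int[mu]_x (Phi (S x (a * l)) `^ p))%E.
apply: (@le_trans _ _ (C%:E * I `^ p^-1)%E); last first.
  apply: lee_wpmul2l; first by rewrite lee_fin ltW.
  by apply: ereal_sup_ubound; exists (a * l).
have C0e : (0 <= C%:E)%E by rewrite lee_fin ltW.
apply: poweR_le_root => //.
- by apply: esum_ge0 => Q _; rewrite mule_ge0// poweR_ge0.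
- by apply: integral_ge0 => x _; exact: poweR_ge0.
have /choice[U HU] : forall Q, exists O, measurable O /\
    (F Q -> O `<=` interior Q /\ mu O = mu Q).
  move=> Q; have [/Fl[z Qz]|nFQ] := pselect (F Q); last first.
    by exists set0; split.
  exists (open_cube z l); split; first exact: measurable_cube (is_cube_at_open z l).
  move=> _; split; first exact: open_cube_sub_interior.
  by rewrite (lebesgue_cube l0 Qz) (lebesgue_cube l0 (is_cube_at_open z l)).
have mU Q : measurable (U Q) by have [] := HU Q.
have Usub Q : F Q -> U Q `<=` interior Q by move=> FQ; have [_ /(_ FQ)[]] := HU Q.
have muU Q : F Q -> mu (U Q) = mu Q by move=> FQ; have [_ /(_ FQ)[]] := HU Q.
have PhiF Q : F Q -> (0 <= Phi Q)%E by move=> /FD; exact: Phi0.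
have Ci0 : (0 <= C^-1%:E)%E by rewrite lee_fin invr_ge0 ltW.
(* The constant C goes to the side of the sum, since multiples of a lower
   integral are harder to handle. *)
pose w Q := ((C^-1%:E * Phi Q) `^ p)%E.
rewrite (eq_esum (b := fun Q => (C%:E `^ p * (w Q * mu (U Q)))%E)); last first.
  move=> Q FQ; rewrite muU// muleA -poweRM ?mule_ge0 ?PhiF//.
  by rewrite muleA -EFinM mulfV ?gt_eqF// mul1e muleC.
apply: le_trans (esumZ_le _ _ _) _ => //.
- exact: poweR_ge0.
- by move=> Q; rewrite mule_ge0// poweR_ge0.
apply: lee_wpmul2l; first exact: poweR_ge0.
apply: packing_le_integral => [//|Q1 Q2 F1 F2 [x [U1 U2]]|Q|x|Q x FQ UQ].
- by apply: tF => //; exists x; split; exact: Usub.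
- exact: poweR_ge0.
- exact: poweR_ge0.
have Qx : Q x by apply: interior_subset; exact: Usub UQ.
have le1 : (C^-1%:E * Phi Q <= Phi (S x (a * l)))%E.
  by rewrite lee_pdivrMl//; apply: cube_le_dilation => //; exact: Fl.
apply: gt0_ler_poweR => //; first exact: ltW.
- by rewrite in_itv/= leey andbT mule_ge0 ?PhiF.
- by rewrite in_itv/= leey andbT Phi0//; exact: SD.
Qed.


(** For a fixed parity class e the doubled cells are disjoint cubes of edge length
    2 ^ (k + 1), hence an admissible family for the dyadic supremum. *)
Lemma grid_sum_le_sup_dyadic p (k : nat) (e : {ffun 'I_n -> bool}) : 1 <= p ->
  (\esum_(m in [set: {ffun 'I_n -> int}])
     (mu (grid_cube (2 ^+ k) e m) * Phi (grid_cube (2 ^+ k) e m) `^ p) <=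
   sup_dyadic_cubes Phi p `^ p)%E.
Proof.
move=> p1; pose Q m : set 'rV[R]_n := grid_cube (2 ^+ k) e m; have p0 : 0 < p by exact: lt_le_trans p1.
have k0 : 0 < 2 ^+ k :> R by rewrite exprn_gt0.
have disjQ m m' x : Q m x -> Q m' x -> m = m' by exact: grid_cubes_disjoint.
have injQ : set_inj setT Q.
  move=> m m' _ _ QQ; pose x := grid_point (2 ^+ k) e m : 'rV[R]_n.
  have Qx : Q m x.
    move=> i; apply/andP; split; have := k0; rewrite /x; lra.
  by apply: (disjQ _ _ x) => //; rewrite -QQ.
rewrite -(esum_image _ _ (fun A => mu A * Phi A `^ p)%E injQ).
set s := esum _ _.
have s0 : (0 <= s)%E by apply: esum_ge0 => A _; rewrite mule_ge0// poweR_ge0.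
have -> : s = ((s `^ p^-1) `^ p)%E.
  by rewrite -poweRrM mulVf ?gt_eqF// poweRe1.
have s_le : (s `^ p^-1 <= sup_dyadic_cubes Phi p)%E.
  apply: ereal_sup_ubound; exists k.+1%:Z; exists (range Q) => //; split.
    move=> _ [m _ <-]; exists (grid_point (2 ^+ k) e m).
    by rewrite -exprnP exprS; exact: is_cube_at_half_open.
  move=> _ _ [m _ <-] [m' _ <-] [x [/interior_subset Qx /interior_subset Qx']].
  by rewrite (disjQ _ _ _ Qx Qx').
apply: gt0_ler_poweR => //; first exact: ltW.
- by rewrite in_itv/= leey poweR_ge0.
- by rewrite in_itv/= leey andbT (le_trans _ s_le)// poweR_ge0.
Qed.

Lemma sup_integral_le_dyadic p : 1 <= p ->
  (sup_integral Phi p S <= C%:E * sup_dyadic_cubes Phi p)%E.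
Proof.
move=> p1; have p0 : 0 < p by exact: lt_le_trans p1.
have C0e : (0 <= C%:E)%E by rewrite lee_fin ltW.
set dyad := sup_dyadic_cubes Phi p.
(* The empty family shows that the supremum is nonnegative. *)
have dyad0 : (0 <= dyad)%E.
  apply: le_trans (poweR_ge0 _ _) _; last apply: ereal_sup_ubound.
  by exists 0; exists set0 => //; split => // A A' [].
apply: ge_ereal_sup => _ [l l0 ->].
have [k lk] : exists k, 2 * l <= 2 ^+ k.
  exists (Num.truncn (2 * l)).+1; apply: ltW; apply: lt_trans (truncnS_gt _) _.
  by rewrite -natrX ltr_nat ltn_expl.
set L := 2 ^+ k in lk; have L0 : 0 < L by rewrite exprn_gt0.
pose J := ({ffun 'I_n -> bool} * {ffun 'I_n -> int})%type.
pose E (j : J) : set 'rV[R]_n := grid_cell L j.1 j.2.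
pose Q (j : J) : set 'rV[R]_n := grid_cube L j.1 j.2.
have QD j : D (Q j).
  by apply: cubesD; exists (2 * L); [rewrite mulr_gt0|exists (grid_point L j.1 j.2); exact: is_cube_at_half_open].
have muQ j : mu (Q j) = ((2 * L) ^+ n)%:E.
  by apply: lebesgue_cube (is_cube_at_half_open _ _); rewrite mulr_gt0.
have muE j : mu (E j) = ((2 ^- n)%:E * mu (Q j))%E.
  rewrite muQ (lebesgue_cube L0 (is_cube_at_half_open _ _)) -EFinM.
  by rewrite exprMn mulKf// expf_neq0.
rewrite -[X in (_ <= _ * X)%E]poweRe1// -(@mulfV _ p) ?gt_eqF// poweRrM.
apply: poweR_le_root => //.
- by apply: integral_ge0 => x _; exact: poweR_ge0.
- exact: poweR_ge0.
apply: (@le_trans _ _ (\esum_(j in setT) ((C%:E * Phi (Q j)) `^ p * mu (E j)))%E).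
  apply: integral_le_covering => [j|j|x|x].
  - exact: measurable_cube (is_cube_at_half_open _ _).
  - exact: poweR_ge0.
  - exact: poweR_ge0.
  have [e [m Ex]] := grid_cell_cover x L0; exists (e, m) => //.
  have SQ : S x l `<=` Q (e, m).
    by apply: subset_trans (S_sub l0) _; exact: sup_ball_sub_grid_cube.
  have Sle : (Phi (S x l) <= C%:E * Phi (Q (e, m)))%E.
    apply: incr => //; first exact: SD.
    have := is_cube_at_sup_ball x l => cube_x.
    apply: (@le_trans _ _ (mu (sup_ball x l))).
      apply: le_measure; rewrite ?inE; [exact: mS| |exact: S_sub].
      exact: measurable_cube cube_x.
    rewrite (lebesgue_cube _ cube_x) ?mulr_gt0// muQ -EFinM lee_fin.
    rewrite (exprMn _ 2 L) mulKf ?expf_neq0//.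
    by apply: lerXn2r; rewrite // nnegrE; [rewrite mulr_ge0// ltW|exact: ltW].
  apply: gt0_ler_poweR => //; first exact: ltW.
  - by rewrite in_itv/= leey andbT Phi0//; exact: SD.
  - by rewrite in_itv/= leey andbT mule_ge0// Phi0.
pose w j := (mu (Q j) * Phi (Q j) `^ p)%E.
have w0 j : (0 <= w j)%E by rewrite mule_ge0// poweR_ge0.
rewrite (eq_esum (b := fun j => (C%:E `^ p * (2 ^- n)%:E * w j)%E)); last first.
  by move=> j _; rewrite poweRM ?Phi0// muE /w -!muleA; congr (_ * _)%E; rewrite muleC -muleA.
have K0 : (0 <= C%:E `^ p * (2 ^- n)%:E)%E.
  by rewrite mule_ge0 ?poweR_ge0// lee_fin invr_ge0 exprn_ge0.
apply: le_trans (esumZ_le _ K0 w0) _.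
rewrite -muleA; apply: lee_wpmul2l; first exact: poweR_ge0.
(* It remains to add up the 2 ^ n parity classes. *)
rewrite lee_pdivrMl ?exprn_gt0//.
have -> : (\esum_(j in setT) w j = \sum_e \esum_(m in setT) w (e, m))%E.
  rewrite -esum_finType; last by move=> e; exact: esum_ge0.
  rewrite (esum_esum (a := fun e m => w (e, m)))//.
  rewrite (_ : _ `*`` _ = setT); last by apply/seteqP; split.
  by apply: eq_esum => -[].
apply: (@le_trans _ _ (\sum_(e : {ffun 'I_n -> bool}) (dyad `^ p))%E).
  by apply: lee_sum => e _; exact: grid_sum_le_sup_dyadic.
by rewrite sumr_const card_ffun card_bool card_ord -natrX mule_natl.
Qed.

Lemma sup_equivalence p : 1 <= p ->
  ereal_sim C (sup_cubes Phi p) (sup_integral Phi p S) /\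
  ereal_sim C (sup_integral Phi p S) (sup_dyadic_cubes Phi p).
Proof.
move=> p1; have C0e : (0 <= C%:E)%E by rewrite lee_fin ltW.
have dyadic_le : (sup_dyadic_cubes Phi p <= sup_cubes Phi p)%E.
  apply: ereal_sup_le => _ [k [F kF ->]].
  by exists (2 ^ k)%R; [rewrite exprz_gt0|exists F].
split; split.
- by rewrite lee_pdivrMl//; exact: sup_cubes_le_integral.
- apply: le_trans (sup_integral_le_dyadic p1) _; exact: lee_wpmul2l.
- by rewrite lee_pdivrMl//; exact: sup_integral_le_dyadic.
- by apply: le_trans dyadic_le _; exact: sup_cubes_le_integral.
Qed.

End comparison.

(** * The equivalences for cubes and for balls *)

(* Q(z, l) may be any of the cubes with center z and edge length l. For balls,
   Phi is defined on cubes and balls, and almost increasing on their union. *)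
Theorem proposition2p5 (R : realType) (n : nat) (Phi : set 'rV[R]_n -> \bar R) :
  (0 < n)%N ->
  (almost_increasing (cubes R n) Phi ->
   exists2 c : R, 0 < c & forall p : R, 1 <= p ->
     forall Q : 'rV[R]_n -> R -> set 'rV[R]_n,
       (forall z l, 0 < l -> is_cube_at z l (Q z l)) ->
     ereal_sim c (sup_cubes Phi p) (sup_integral Phi p Q) /\
     ereal_sim c (sup_integral Phi p Q) (sup_dyadic_cubes Phi p))
  /\
  (almost_increasing (cubes R n `|` balls R n) Phi ->
   exists2 c : R, 0 < c & forall p : R, 1 <= p ->
     ereal_sim c (sup_cubes Phi p) (sup_integral Phi p (@eball R n)) /\
     ereal_sim c (sup_integral Phi p (@eball R n)) (sup_dyadic_cubes Phi p)).
Proof.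
move=> _; split.
  move=> [Phi0 [C C0 incr]]; exists C => // p p1 Q Qcube.
  apply: (@sup_equivalence R n (cubes R n) Phi C _ C0 Phi0 incr Q 4) => // z l l0.
  - by exists l => //; exists z; exact: Qcube.
  - exact: measurable_cube (Qcube z l l0).
  - apply: subset_trans (cube_sub_sup_ball (Qcube z l l0)) _ => x h i.
    by apply: le_trans (h i) _; lra.
  - have l40 : 0 < 4 * l by rewrite mulr_gt0.
    apply: subset_trans (open_cube_sub (Qcube z _ l40)) => x h i.
    by have := h i; rewrite ler_distl => /andP[? ?]; apply/andP; split; lra.
move=> [Phi0 [C C0 incr]]; exists C => // p p1.
apply: (@sup_equivalence R n _ Phi C _ C0 Phi0 incr (@eball R n) n.+1%:R) => //.
- by move=> z l l0; right; exists z, l.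
- exact: measurable_eball.
- by move=> z l _; exact: eball_sub_sup_ball.
- exact: sup_ball_sub_eball.
Qed.
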